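(* Let $\mathbb{K}$ be an algebraically closed field of characteristic $0$ and let $\mathfrak{g}$ be a Lie algebra over $\mathbb{K}$. Let $h:\operatorname{B}(\mathfrak{g},\mathbb{K})\to\operatorname{H}^3(\mathfrak{g},\mathbb{K})$ be the Cartan--Koszul map. Then $$\frac{\operatorname{HL}^2(\mathfrak{g},\mathbb{K})}{\operatorname{H}^2(\mathfrak{g},\mathbb{K})}=\ker(h).$$ In particular, $\operatorname{HL}^2(\mathfrak{g},\mathbb{K})=\operatorname{H}^2(\mathfrak{g},\mathbb{K})$ if and only if $\ker(h)=0$.
   Context: $\operatorname{H}^*(\mathfrak{g},\mathbb{K})$ is Chevalley--Eilenberg cohomology with trivial coefficients. $\operatorname{HL}^*(\mathfrak{g},\mathbb{K})$ is Leibniz cohomology with trivial coefficients, computed from $C^n(\mathfrak{g},\mathbb{K})=\operatorname{Hom}_{\mathbb{K}}(\mathfrak{g}^{\otimes n},\mathbb{K})$ with the Loday coboundary $(d^n f)(x_1,\dots,x_{n+1})=\sum_{1\le i<j\le n+1}(-1)^{j+1}f(x_1,\dots,x_{i-1},[x_i,x_j],x_{i+1},\dots,\hat{x}_j,\dots,x_{n+1})$. Thus a Leibniz $2$-cocycle is a bilinear form $\alpha$ on $\mathfrak{g}$ with $\alpha(x,[y,z])=\alpha([x,y],z)-\alpha([x,z],y)$, and $2$-coboundaries are $(x,y)\mapsto-\beta([x,y])$ with $\beta\in\mathfrak{g}^*$. $\operatorname{H}^2(\mathfrak{g},\mathbb{K})$ is regarded as a subspace of $\operatorname{HL}^2(\mathfrak{g},\mathbb{K})$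 via the natural embedding (a Lie $2$-cocycle is in particular a Leibniz $2$-cocycle); ''$\operatorname{HL}^2=\operatorname{H}^2$'' means that this embedding is onto. The first equality is the isomorphism of vector spaces induced by the map $\operatorname{HL}^2(\mathfrak{g},\mathbb{K})\to\operatorname{B}(\mathfrak{g},\mathbb{K})$ sending $\alpha$ to $(x,y)\mapsto\alpha(x,y)+\alpha(y,x)$. $\operatorname{B}(\mathfrak{g},\mathbb{K})$ is the space of $\mathbb{K}$-valued symmetric bilinear forms $\phi$ on $\mathfrak{g}$ with $\phi([x,y],z)=\phi(x,[y,z])$ for all $x,y,z$. The Cartan--Koszul map sends $\alpha\in\operatorname{B}(\mathfrak{g},\mathbb{K})$ to the class of the $3$-cocycle $(x,y,z)\mapsto\alpha([x,y],z)$. *)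

(* Defs.v *)
From HB Require Import structures.
From mathcomp Require Import all_boot all_algebra.
From mathcomp Require Import boolp functions.

Set Implicit Arguments.
Unset Strict Implicit.
Unset Printing Implicit Defensive.

Import GRing.Theory.

Local Open Scope ring_scope.
Local Open Scope quotient_scope.

HB.mixin Record isLieAlgebra (K : fieldType) (L : Type) of GRing.Lmodule K L := {
  lie : L -> L -> L;
  lie_linearl : forall y, linear (lie^~ y);
  lie_linearr : forall x, linear (lie x);
  liexx : forall x, lie x x = 0;
  lie_jacobi : forall x y z,
    lie x (lie y z) + lie y (lie z x) + lie z (lie x y) = 0
}.

#[short(type="lieAlgebraType")]
HB.structure Definition LieAlgebra (K : fieldType) :=
  {L of isLieAlgebra K L & GRing.Lmodule K L}.

Section SubspaceQuotient.
Variables (K : fieldType) (V : lmodType K) (P : submodClosed V).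

Definition subspace : Type := {v : V | v \in P}.
HB.instance Definition _ := SubChoice.on subspace.
HB.instance Definition _ := [SubChoice_isSubLmodule of subspace by <:].

Lemma val_subspaceP a (u v : subspace) : val (a *: u + v) = a *: val u + val v.
Proof. by []. Qed.

Definition mk_subspace (v : V) (Pv : v \in P) : subspace := exist _ v Pv.

(* MathComp's [submodClosed] does not extend [zmodClosed], which
   [Quotient.quot] requires. *)
Definition zmod_of_submod : {pred V} := fun v => v \in P.

Fact zmod_of_submod_closed : zmod_closed zmod_of_submod.
Proof. exact: GRing.submod_closedB (submodClosedP P). Qed.
HB.instance Definition _ :=
  GRing.isZmodClosed.Build V zmod_of_submod zmod_of_submod_closed.

Definition quotient : Type := Quotient.quot zmod_of_submod.
HB.instance Definition _ := GRing.Zmodule.on quotient.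

Definition quotient_pi (v : V) : quotient := \pi_(Quotient.quot zmod_of_submod) v.
Definition quotient_repr (q : quotient) : V :=
  @repr V (Quotient.quot zmod_of_submod) q.

Lemma quotient_reprK : cancel quotient_repr quotient_pi.
Proof. by move=> q; apply: reprK. Qed.

Lemma quotient_piP (x y : V) : quotient_pi x = quotient_pi y <-> x - y \in P.
Proof.
rewrite -[_ \in P]/(x - y \in zmod_of_submod) Quotient.idealrBE.
by split=> [/eqP|/eqP].
Qed.

Fact quotient_pi_zmod : zmod_morphism quotient_pi.
Proof. exact: (raddfB (\pi_(Quotient.quot zmod_of_submod))). Qed.
HB.instance Definition _ :=
  GRing.isZmodMorphism.Build V quotient quotient_pi quotient_pi_zmod.

Definition quotient_scale (a : K) (q : quotient) : quotient :=
  quotient_pi (a *: quotient_repr q).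

Lemma quotient_scaleE a x :
  quotient_scale a (quotient_pi x) = quotient_pi (a *: x).
Proof.
apply/quotient_piP; rewrite -scalerBr rpredZ //.
by apply/quotient_piP; rewrite quotient_reprK.
Qed.

Fact quotient_scaleA a b v :
  quotient_scale a (quotient_scale b v) = quotient_scale (a * b) v.
Proof. by rewrite -[v]quotient_reprK !quotient_scaleE scalerA. Qed.
Fact quotient_scale1 : left_id 1 quotient_scale.
Proof. by move=> v; rewrite -[v]quotient_reprK quotient_scaleE scale1r. Qed.
Fact quotient_scaleDr : right_distributive quotient_scale +%R.
Proof.
move=> a u v; rewrite -[u]quotient_reprK -[v]quotient_reprK.
by rewrite -raddfD !quotient_scaleE scalerDr raddfD.
Qed.
Fact quotient_scaleDl v : {morph quotient_scale^~ v : a b / a + b}.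
Proof.
by move=> a b; rewrite -[v]quotient_reprK !quotient_scaleE scalerDl raddfD.
Qed.
HB.instance Definition _ := GRing.Zmodule_isLmodule.Build K quotient
  quotient_scaleA quotient_scale1 quotient_scaleDr quotient_scaleDl.

Fact quotient_pi_scalable : scalable quotient_pi.
Proof. by move=> a v; rewrite -quotient_scaleE. Qed.
HB.instance Definition _ :=
  GRing.isScalable.Build K V quotient *:%R quotient_pi quotient_pi_scalable.

End SubspaceQuotient.

Section KernelRange.
Variables (K : fieldType) (U V : lmodType K) (f : {linear U -> V}).

Definition ker_pred : {pred U} := fun u => f u == 0.
Fact ker_pred_closed : submod_closed ker_pred.
Proof.
split=> [|a u v]; first by apply/eqP; rewrite linear0.
move=> /eqP fu /eqP fv; apply/eqP.
by rewrite linearP fu fv scaler0 addr0.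
Qed.
HB.instance Definition _ := GRing.isSubmodClosed.Build K U ker_pred
  (GRing.submod_closed_semi ker_pred_closed).

Definition range_pred : {pred V} := fun v => `[< exists u, f u = v >].
Fact range_pred_closed : submod_closed range_pred.
Proof.
split=> [|a u v].
  by apply/asboolP; exists 0; rewrite linear0.
move=> /asboolP[u' <-] /asboolP[v' <-].
by apply/asboolP; exists (a *: u' + v'); rewrite linearP.
Qed.
HB.instance Definition _ := GRing.isSubmodClosed.Build K V range_pred
  (GRing.submod_closed_semi range_pred_closed).

End KernelRange.

Section Cohomology.
Variables (K : fieldType) (g : lieAlgebraType K).

(* All K-valued functions of n arguments in g; the n-cochains are the
   multilinear (resp. alternating multilinear) ones among them. *)
Definition mapn (n : nat) : Type := ('I_n -> g) -> K^o.
HB.instance Definition _ n := GRing.Lmodule.on (mapn n).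

Definition multilinear n (f : mapn n) : Prop :=
  forall (x : 'I_n -> g) (i : 'I_n), scalar (fun u => f [eta x with i |-> u]).

Definition alternating n (f : mapn n) : Prop :=
  forall (x : 'I_n -> g) (i j : 'I_n), i != j -> x i = x j -> f x = 0.

(* Indices start at 0, so the sign (-1)^(j+1) of the 1-based formula
   becomes (-1)^j. *)
Definition loday_d n (f : mapn n) : mapn n.+1 := fun x =>
  \sum_(j < n.+1) \sum_(i < n.+1 | (i < j)%N)
    (-1) ^+ j * f (fun k : 'I_n =>
      if lift j k == i then lie (x i) (x j) else x (lift j k)).

(* For i < j, [bump j (bump i k)] is the k-th index different from i and j;
   it is at most n in the range where it is used, so that [inord] does not
   alter it. *)
Definition ce_d n (f : mapn n) : mapn n.+1 := fun x =>
  \sum_(j < n.+1) \sum_(i < n.+1 | (i < j)%N)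
    (-1) ^+ (i + j) * f (fun k : 'I_n =>
      if k == 0%N :> nat then lie (x i) (x j)
      else x (inord (bump j (bump i k.-1)))).

Definition leibniz_cochain n (f : mapn n) : Prop := multilinear f.
Definition lie_cochain n (f : mapn n) : Prop := multilinear f /\ alternating f.

Definition leibniz_cocycle n : {pred mapn n} := fun f =>
  `[< leibniz_cochain f /\ loday_d f = 0 >].
Definition lie_cocycle n : {pred mapn n} := fun f =>
  `[< lie_cochain f /\ ce_d f = 0 >].

Definition leibniz_exact n : mapn n -> Prop :=
  match n with
  | 0 => fun f => f = 0
  | m.+1 => fun f => exists2 b : mapn m, leibniz_cochain b & f = loday_d b
  end.
Definition lie_exact n : mapn n -> Prop :=
  match n with
  | 0 => fun f => f = 0
  | m.+1 => fun f => exists2 b : mapn m, lie_cochain b & f = ce_d b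
  end.

Fact multilinear_lin n a (f1 f2 : mapn n) :
  multilinear f1 -> multilinear f2 -> multilinear (a *: f1 + f2).
Proof.
move=> h1 h2 x i b u v.
have E (y : 'I_n -> g) : (a *: f1 + f2) y = a * f1 y + f2 y by [].
by rewrite !E h1 h2 !mulrDr mulrCA addrACA.
Qed.

Fact alternating_lin n a (f1 f2 : mapn n) :
  alternating f1 -> alternating f2 -> alternating (a *: f1 + f2).
Proof.
move=> h1 h2 x i j ij xij.
have -> : (a *: f1 + f2) x = a * f1 x + f2 x by [].
by rewrite (h1 x i j) // (h2 x i j) // mulr0 addr0.
Qed.

Fact multilinear0 n : multilinear (0 : mapn n).
Proof. by move=> x i b u v; rewrite mulr0 addr0. Qed.

Fact loday_d_linear n : linear (@loday_d n).
Proof.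
move=> a f1 f2; apply/funext => x.
have -> : (a *: loday_d f1 + loday_d f2) x = a * loday_d f1 x + loday_d f2 x by [].
rewrite /loday_d mulr_sumr -big_split; apply: eq_bigr => j _ /=.
rewrite mulr_sumr -big_split; apply: eq_bigr => i _ /=.
by rewrite -[X in _ * X]/(a * _ + _) mulrDr mulrCA.
Qed.
HB.instance Definition _ n := GRing.isLinear.Build K (mapn n) (mapn n.+1) *:%R
  (@loday_d n) (@loday_d_linear n).

Fact ce_d_linear n : linear (@ce_d n).
Proof.
move=> a f1 f2; apply/funext => x.
have -> : (a *: ce_d f1 + ce_d f2) x = a * ce_d f1 x + ce_d f2 x by [].
rewrite /ce_d mulr_sumr -big_split; apply: eq_bigr => j _ /=.
rewrite mulr_sumr -big_split; apply: eq_bigr => i _ /=.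
by rewrite -[X in _ * X]/(a * _ + _) mulrDr mulrCA.
Qed.
HB.instance Definition _ n := GRing.isLinear.Build K (mapn n) (mapn n.+1) *:%R
  (@ce_d n) (@ce_d_linear n).

Fact leibniz_cocycle_closed n : submod_closed (@leibniz_cocycle n).
Proof.
split=> [|a u v].
  by apply/asboolP; split; [exact: multilinear0 | rewrite linear0].
move=> /asboolP[mu du] /asboolP[mv dv]; apply/asboolP; split.
  exact: multilinear_lin.
by rewrite loday_d_linear du dv scaler0 addr0.
Qed.
HB.instance Definition _ n := GRing.isSubmodClosed.Build K (mapn n)
  (@leibniz_cocycle n) (GRing.submod_closed_semi (@leibniz_cocycle_closed n)).

Fact lie_cocycle_closed n : submod_closed (@lie_cocycle n).
Proof.
split=> [|a u v].
  apply/asboolP; split; last by rewrite linear0.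
  by split; [exact: multilinear0 | move=> ? ?].
move=> /asboolP[[mu au] du] /asboolP[[mv av] dv]; apply/asboolP; split.
  by split; [exact: multilinear_lin | exact: alternating_lin].
by rewrite ce_d_linear du dv scaler0 addr0.
Qed.
HB.instance Definition _ n := GRing.isSubmodClosed.Build K (mapn n)
  (@lie_cocycle n) (GRing.submod_closed_semi (@lie_cocycle_closed n)).

Definition ZL n := subspace (@leibniz_cocycle n).
HB.instance Definition _ n := GRing.Lmodule.on (ZL n).
Definition ZCE n := subspace (@lie_cocycle n).
HB.instance Definition _ n := GRing.Lmodule.on (ZCE n).

(* Since d o d = 0, exact cochains are cocycles; taking the exact ones among the
   cocycles avoids having to prove it here in every degree. *)
Definition leibniz_coboundary n : {pred ZL n} := fun z =>
  `[< leibniz_exact (val z) >].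
Definition lie_coboundary n : {pred ZCE n} := fun z =>
  `[< lie_exact (val z) >].

Fact leibniz_coboundary_closed n : submod_closed (@leibniz_coboundary n).
Proof.
split=> [|a u v].
  apply/asboolP; case: n => [|n] //=.
  by exists 0; [exact: multilinear0 | rewrite linear0].
move=> /asboolP hu /asboolP hv; apply/asboolP.
have := val_subspaceP a u v => ->.
case: n u v hu hv => [|n] u v /=.
  by move=> -> ->; rewrite scaler0 addr0.
move=> [b mb ->] [c mc ->]; exists (a *: b + c).
  exact: multilinear_lin.
by rewrite loday_d_linear.
Qed.
HB.instance Definition _ n := GRing.isSubmodClosed.Build K (ZL n)
  (@leibniz_coboundary n) (GRing.submod_closed_semi (@leibniz_coboundary_closed n)).

Fact lie_coboundary_closed n : submod_closed (@lie_coboundary n).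
Proof.
split=> [|a u v].
  apply/asboolP; case: n => [|n] //=.
  exists 0; last by rewrite linear0.
  by split; [exact: multilinear0 | move=> ? ?].
move=> /asboolP hu /asboolP hv; apply/asboolP.
have := val_subspaceP a u v => ->.
case: n u v hu hv => [|n] u v /=.
  by move=> -> ->; rewrite scaler0 addr0.
move=> [b [mb ab] ->] [c [mc ac] ->]; exists (a *: b + c).
  by split; [exact: multilinear_lin | exact: alternating_lin].
by rewrite ce_d_linear.
Qed.
HB.instance Definition _ n := GRing.isSubmodClosed.Build K (ZCE n)
  (@lie_coboundary n) (GRing.submod_closed_semi (@lie_coboundary_closed n)).

Definition HL n := quotient (@leibniz_coboundary n).
HB.instance Definition _ n := GRing.Lmodule.on (HL n).
Definition HCE n := quotient (@lie_coboundary n).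
HB.instance Definition _ n := GRing.Lmodule.on (HCE n).

Definition leibniz_class n : ZL n -> HL n := quotient_pi (@leibniz_coboundary n).
HB.instance Definition _ n := GRing.Linear.on (@leibniz_class n).
Definition lie_class n : ZCE n -> HCE n := quotient_pi (@lie_coboundary n).
HB.instance Definition _ n := GRing.Linear.on (@lie_class n).

Definition bform : Type := g -> g -> K^o.
HB.instance Definition _ := GRing.Lmodule.on bform.

Definition invariant_form : {pred bform} := fun phi =>
  `[< [/\ forall y, scalar (phi^~ y), forall x, scalar (phi x),
          forall x y, phi x y = phi y x
        & forall x y z, phi (lie x y) z = phi x (lie y z)] >].

Fact invariant_form_closed : submod_closed invariant_form.
Proof.
split=> [|a u v].
  by apply/asboolP; split=> // x b s t /=; rewrite mulr0 addr0.
move=> /asboolP[ul ur us ui] /asboolP[vl vr vs vi].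
have E x y : (a *: u + v) x y = a * u x y + v x y by [].
apply/asboolP; split=> [y b s t|x b s t|x y|x y z]; rewrite !E.
- by rewrite ul vl !mulrDr mulrCA addrACA.
- by rewrite ur vr !mulrDr mulrCA addrACA.
- by rewrite us vs.
- by rewrite ui vi.
Qed.
HB.instance Definition _ := GRing.isSubmodClosed.Build K bform
  invariant_form (GRing.submod_closed_semi invariant_form_closed).

Definition B := subspace invariant_form.
HB.instance Definition _ := GRing.Lmodule.on B.

Lemma lieC (x y : g) : lie x y = - lie y x.
Proof.
apply/eqP; rewrite -addr_eq0.
have lieDl u v w : lie (u + v) w = lie u w + lie v w :> g.
  by have := lie_linearl w 1 u v; rewrite !scale1r.
have lieDr u v w : lie u (v + w) = lie u v + lie u w :> g.
  by have := lie_linearr u 1 v w; rewrite !scale1r.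
have := liexx (x + y); rewrite lieDl !lieDr !liexx add0r addr0.
by move=> ->.
Qed.

Lemma ce_dE n (f : mapn n) (y : nat -> g) :
  ce_d f (fun i : 'I_n.+1 => y i) =
  \sum_(j < n.+1) \sum_(i < n.+1 | (i < j)%N)
    (-1) ^+ (i + j) * f (fun k : 'I_n =>
      if k == 0%N :> nat then lie (y i) (y j) else y (bump j (bump i k.-1))).
Proof.
apply: eq_bigr => j _; apply: eq_bigr => i ij; congr (_ * f _).
apply/funext => k; case: ifP => // k0; congr (y _).
rewrite inordK // ltnS /bump; have := ltn_ord k; move: k0.
case: (nat_of_ord k) => // m /= _; apply: leq_trans.
by rewrite -[m.+2]/(1 + (1 + m))%N !leq_add ?leq_b1.
Qed.

Lemma loday_dE n (f : mapn n) (y : nat -> g) :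
  loday_d f (fun i : 'I_n.+1 => y i) =
  \sum_(j < n.+1) \sum_(i < n.+1 | (i < j)%N)
    (-1) ^+ j * f (fun k : 'I_n =>
      if bump j k == i then lie (y i) (y j) else y (bump j k)).
Proof. by []. Qed.

Lemma ord_funE n (x : 'I_n.+1 -> g) :
  exists y : nat -> g, x = (fun i : 'I_n.+1 => y i).
Proof. by exists (fun m => x (inord m)); apply/funext => i; rewrite inord_val. Qed.

Lemma lieNl (x y : g) : lie (- x) y = - lie x y.
Proof.
have l0 : lie 0 y = 0 :> g.
  by have := lie_linearl y (-1) 0 0; rewrite scaler0 addr0 scaleN1r addNr.
by have := lie_linearl y (-1) x 0; rewrite l0 !addr0 !scaleN1r.
Qed.

Lemma lieNr (x y : g) : lie x (- y) = - lie x y.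
Proof. by rewrite lieC lieNl (lieC y) opprK. Qed.

Definition koszul_cochain (phi : bform) : mapn 3 :=
  fun x => phi (lie (x 0) (x 1)) (x 2).

Fact koszul_cocycle (phi : B) : koszul_cochain (val phi) \in @lie_cocycle 3.
Proof.
case: phi => phi /= /asboolP[pl pr ps pi].
have phi0l y : phi 0 y = 0.
  by have := pl y (-1) 0 0; rewrite scaler0 addr0 mulN1r addNr.
have phi0r x : phi x 0 = 0 by rewrite ps.
have phiNr x y : phi x (- y) = - phi x y.
  by have := pr x (-1) y 0; rewrite scaleN1r !addr0 phi0r addr0 mulN1r.
have phiNl x y : phi (- x) y = - phi x y by rewrite ps phiNr ps.
have phiDr x u v : phi x (u + v) = phi x u + phi x v.
  by have := pr x 1 u v; rewrite scale1r mul1r.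
apply/asboolP; split; first split.
- move=> x [[|[|[|m]]] hi] b u v //; rewrite /koszul_cochain /=.
  + by rewrite lie_linearl pl.
  + by rewrite lie_linearr pl.
  + by rewrite pr.
- have A01 (a b : g) : phi (lie a a) b = 0 by rewrite liexx.
  have A12 (a b : g) : phi (lie a b) b = 0 by rewrite pi liexx.
  have A02 (a b : g) : phi (lie a b) a = 0 by rewrite lieC phiNl A12 oppr0.
  have x0E h (x : 'I_3 -> g) : x (@Ordinal 3 0 h) = x 0 by congr x; apply: val_inj.
  have x1E h (x : 'I_3 -> g) : x (@Ordinal 3 1 h) = x 1 by congr x; apply: val_inj.
  have x2E h (x : 'I_3 -> g) : x (@Ordinal 3 2 h) = x 2 by congr x; apply: val_inj.
  move=> x [[|[|[|?]]] hi] [[|[|[|?]]] hj] //= _;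
    rewrite ?(x0E, x1E, x2E) /koszul_cochain => e;
    by rewrite ?A01 // -?e ?A01 ?A02 ?A12 // ?e ?A01 ?A02 ?A12.
- apply/funext => x; have [y ->] := ord_funE x; rewrite (ce_dE _ y).
  rewrite !big_ord_recl big_ord0 /=.
  rewrite !(big_mkcond (fun i : 'I_4 => (i < _)%N)) /=.
  rewrite !big_ord_recl !big_ord0 /= /koszul_cochain /=.
  rewrite /bump /= !(add0n, add1n, addn0, addn1, add0r, addr0) /=.
  rewrite !pi.
  have sw a b c d : phi a (lie b (lie c d)) = phi c (lie d (lie a b)).
    by rewrite -pi ps pi.
  rewrite (sw (y 1%N) (y 2%N)) (sw (y 1%N) (y 3%N)) (sw (y 2%N) (y 3%N)).
  have J : phi (y 0%N) (lie (y 2%N) (lie (y 1%N) (y 3%N))) =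
      phi (y 0%N) (lie (y 1%N) (lie (y 2%N) (y 3%N))) +
      phi (y 0%N) (lie (y 3%N) (lie (y 1%N) (y 2%N))).
    have := congr1 (phi (y 0%N)) (lie_jacobi (y 1%N) (y 2%N) (y 3%N)).
    rewrite (lieC (y 3%N) (y 1%N)) phi0r !phiDr.
    rewrite lieNr phiNr addrAC => /eqP; rewrite subr_eq0 => /eqP <- //.
  rewrite J !exprS !expr0 !mulr1 !mulrNN !mulr1 !mulN1r !mul1r.
  rewrite !opprK !mul1r !mulN1r.
  have id (a c : K) : - a + (a + c - c + (- c + (a + c - a))) = 0.
    by rewrite addrK (addrC a c) addrK addNr addr0 addNr.
  exact: id.
Qed.

Definition koszul_Z (phi : B) : ZCE 3 := mk_subspace (koszul_cocycle phi).

Fact koszul_Z_linear : linear koszul_Z.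
Proof. by move=> a u v; apply: val_inj. Qed.

Definition cartan_koszul (phi : B) : HCE 3 := lie_class (koszul_Z phi).

Fact cartan_koszul_linear : linear cartan_koszul.
Proof. by move=> a u v; rewrite /cartan_koszul koszul_Z_linear linearP. Qed.
HB.instance Definition _ := GRing.isLinear.Build K B (HCE 3) *:%R
  cartan_koszul cartan_koszul_linear.

Lemma ce_d1 (f : mapn 1) : ce_d f = loday_d f.
Proof.
apply/funext => x; have [y ->] := ord_funE x; rewrite (ce_dE _ y) (loday_dE _ y).
apply: eq_bigr => -[[|[|j]] hj] // _; apply: eq_bigr => -[[|[|i]] hi] //= _.
by congr (_ * f _); apply/funext => -[[|k] hk].
Qed.

Lemma alternating2 (f : mapn 2) (p q : 'I_2 -> g) : lie_cochain f ->
  p 0 = q 1 -> p 1 = q 0 -> f p = - f q.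
Proof.
move=> [mf af] p0 p1.
pose x u v : 'I_2 -> g := fun k => if k == 0 then u else v.
pose F u v : K := f (x u v).
have Fl v a u w : F (a *: u + w) v = a * F u v + F w v.
  have E u' : x u' v = [eta x 0 v with (0 : 'I_2) |-> u'].
    by apply/funext => k; rewrite /x /=; case: (k == 0).
  by rewrite /F (E (_ + _)) (E u) (E w); exact: (mf (x 0 v) 0 a u w).
have Fr u a v w : F u (a *: v + w) = a * F u v + F u w.
  have E v' : x u v' = [eta x u 0 with (1 : 'I_2) |-> v'].
    by apply/funext => -[[|[|k]] hk].
  by rewrite /F (E (_ + _)) (E v) (E w); exact: (mf (x u 0) 1 a v w).
have Fd u : F u u = 0 by apply: (af _ 0 1).
have E (r : 'I_2 -> g) : r = x (r 0) (r 1).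
  apply/funext => -[[|[|k]] hk] //; rewrite /x /=; congr r; exact: val_inj.
rewrite (E p) (E q) p0 p1 -/(F _ _) -/(F _ _); apply/eqP; rewrite -addr_eq0.
have := Fd (q 0 + q 1); rewrite -[q 0 + q 1](congr1 (+%R^~ (q 1)) (scale1r (q 0))).
by rewrite Fl !Fr !Fd !mul1r add0r addr0 addrC => ->.
Qed.

Lemma ce_d2 (f : mapn 2) : lie_cochain f -> ce_d f = loday_d f.
Proof.
move=> hf; apply/funext => x; have [y ->] := ord_funE x.
rewrite (ce_dE _ y) (loday_dE _ y).
apply: eq_bigr => -[[|[|[|j]]] hj] // _; apply: eq_bigr => -[[|[|[|i]]] hi] //= _;
  try by congr (_ * f _); apply/funext => -[[|[|k]] hk].
set p := (X in _ * f X = _); set q := (X in _ = _ * f X).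
rewrite (alternating2 (p := p) (q := q) hf) // !exprS !expr0 !mulr1 !mulrN !mulN1r.
by rewrite !opprK mulN1r opprK mul1r.
Qed.

Fact lie2_leibniz_cocycle (z : ZCE 2) : val z \in @leibniz_cocycle 2.
Proof.
case: z => z /= /asboolP[hz dz]; apply/asboolP; split; first by case: hz.
by rewrite -ce_d2.
Qed.

Definition lie2_leibniz (z : ZCE 2) : ZL 2 := mk_subspace (lie2_leibniz_cocycle z).

Lemma lie2_leibniz_coboundary (z : ZCE 2) :
  (lie2_leibniz z \in @leibniz_coboundary 2) = (z \in @lie_coboundary 2).
Proof.
apply/asboolP/asboolP => /= -[b].
  move=> mb ->; exists b; last by rewrite ce_d1.
  by split=> // x [[|i] hi] [[|j] hj].
by move=> [mb _] ->; exists b; last by rewrite ce_d1.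
Qed.

Fact lie2_leibniz_linear : linear lie2_leibniz.
Proof. by move=> a u v; apply: val_inj. Qed.

(* Computed on a representative; [H2_to_HL2_class] shows that the choice is
   irrelevant. *)
Definition H2_to_HL2 (c : HCE 2) : HL 2 :=
  leibniz_class (lie2_leibniz (quotient_repr c)).

Lemma lie2_leibnizB u v : lie2_leibniz (u - v) = lie2_leibniz u - lie2_leibniz v.
Proof. by apply: val_inj. Qed.

Lemma H2_to_HL2_class (z : ZCE 2) :
  H2_to_HL2 (lie_class z) = leibniz_class (lie2_leibniz z).
Proof.
apply/quotient_piP; rewrite -lie2_leibnizB lie2_leibniz_coboundary.
by apply/quotient_piP; apply: quotient_reprK.
Qed.

Lemma lie_class_surj (c : HCE 2) : exists z, c = lie_class z.
Proof. by exists (quotient_repr c); rewrite /lie_class quotient_reprK. Qed.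

Fact H2_to_HL2_linear : linear H2_to_HL2.
Proof.
move=> a u v; have [x ->] := lie_class_surj u; have [y ->] := lie_class_surj v.
by rewrite -linearP !H2_to_HL2_class lie2_leibniz_linear linearP.
Qed.
HB.instance Definition _ := GRing.isLinear.Build K (HCE 2) (HL 2) *:%R
  H2_to_HL2 H2_to_HL2_linear.

Lemma H2_to_HL2_inj : injective H2_to_HL2.
Proof.
move=> u v; have [x ->] := lie_class_surj u; have [y ->] := lie_class_surj v.
rewrite !H2_to_HL2_class => /quotient_piP.
by rewrite -lie2_leibnizB lie2_leibniz_coboundary => h; apply/quotient_piP.
Qed.

Definition pair2 (x y : g) : 'I_2 -> g := tnth [tuple x; y].

Lemma loday_d2E (f : mapn 2) (x y z : g) :
  loday_d f (tnth [tuple x; y; z]) =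
  f (pair2 x (lie y z)) + f (pair2 (lie x z) y) - f (pair2 (lie x y) z).
Proof.
have -> : tnth [tuple x; y; z] = (fun i : 'I_3 => nth 0 [:: x; y; z] i).
  by apply/funext => i; rewrite (tnth_nth 0).
rewrite (loday_dE _ (nth 0 [:: x; y; z])) !big_ord_recl big_ord0.
rewrite !(big_mkcond (fun i : 'I_3 => (i < _)%N)) /=.
rewrite !big_ord_recl !big_ord0 /= !addr0 !add0r.
rewrite !exprS !expr0 !mulr1 !mulrNN !mulr1 !mulN1r !mul1r.
have E (h : 'I_2 -> g) u v : h ord0 = u -> h ord_max = v -> h = pair2 u v.
  move=> <- <-; apply/funext => -[[|[|k]] hk] //; rewrite /pair2 (tnth_nth 0) /=;
  congr h; exact: val_inj.
rewrite [LHS]addrC; congr (_ + _); last by congr (- f _); apply: E.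
by rewrite [LHS]addrC; congr (_ + _); congr (f _); apply: E.
Qed.

Definition symmetrization (alpha : mapn 2) : bform :=
  fun x y => alpha (pair2 x y) + alpha (pair2 y x).

End Cohomology.

Arguments H2_to_HL2 {K} g c.
Arguments cartan_koszul {K} g phi.

(* Main.v *)
Require Import Defs.
From HB Require Import structures.
From mathcomp Require Import all_boot all_algebra.
From mathcomp Require Import boolp functions.

(** The idea is to split a Leibniz 2-cocycle [alpha] into its symmetric part
    [phi], with [phi x y = alpha x y + alpha y x], and its alternating part
    [omega = 2 alpha - phi].

    The cocycle identity for [alpha] makes [phi] invariant
    ([symmetrization_invariant]).  For an invariant symmetric form the Loday
    coboundary collapses, by cyclic symmetry of [phi([x, y], z)], to minus its
    Koszul cochain ([loday_d_invariant_form]).  Since the Loday and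
    Chevalley-Eilenberg differentials agree on alternating 2-cochains, the
    identity [d alpha = 0] reads [d omega = koszul phi]: the form [phi] lies in
    the kernel of the Cartan-Koszul map, with [omega] as a primitive of its
    Koszul cochain ([koszul_symmetrization_exact]).  The computation can be run
    backwards when 2 is invertible: a primitive [omega] of [koszul phi] gives
    the Leibniz cocycle [(phi + omega) / 2], whose symmetrization is [phi]
    ([sym_ker_surj]).

    So symmetrization is a surjection from Leibniz 2-cocycles onto the kernel of
    the Cartan-Koszul map.  It kills exactly the alternating cocycles, that is
    the Lie ones; these contain the coboundaries, which are [beta([x, y])] up to
    sign.  The isomorphism is the induced map on the two successive quotients,
    first by coboundaries, then by the image of Lie cohomology. *)

Set Implicit Arguments.
Unset Strict Implicit.
Unset Printing Implicit Defensive.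

Import GRing.Theory.

Local Open Scope ring_scope.

(** * Subspaces and quotients *)

Lemma val_subspaceZ (K : fieldType) (V : lmodType K) (P : submodClosed V)
  (a : K) (u : subspace P) : val (a *: u) = a *: val u.
Proof. by []. Qed.

Section QuotientLift.
Variables (K : fieldType) (U V : lmodType K) (P : submodClosed U).
Variable f : {linear U -> V}.

(** The vanishing hypothesis is an argument, so that linearity of the lift can
    be inferred from the term alone. *)
Definition quotient_lift (fP : forall u, u \in P -> f u = 0) (q : quotient P) : V :=
  f (quotient_repr q).

Hypothesis fP : forall u, u \in P -> f u = 0.

Lemma quotient_liftE u : quotient_lift fP (quotient_pi P u) = f u.
Proof.
apply/eqP; rewrite -subr_eq0 -linearB; apply/eqP/fP.
by apply/quotient_piP; apply: quotient_reprK.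
Qed.

Fact quotient_lift_linear : linear (quotient_lift fP).
Proof.
move=> a p q; rewrite -[p]quotient_reprK -[q]quotient_reprK.
by rewrite -linearP !quotient_liftE linearP.
Qed.
HB.instance Definition _ := GRing.isLinear.Build K (quotient P) V *:%R
  (quotient_lift fP) quotient_lift_linear.

Lemma quotient_lift_bij :
  (forall u, f u = 0 -> u \in P) -> (forall v, exists u, f u = v) ->
  bijective (quotient_lift fP).
Proof.
move=> kerf /choice[s sK]; exists (fun v => quotient_pi P (s v)) => [q|v].
  rewrite -[q]quotient_reprK quotient_liftE; apply/quotient_piP/kerf.
  by rewrite linearB sK subrr.
by rewrite quotient_liftE.
Qed.

End QuotientLift.

(** * Bilinear forms as 2-cochains *)

Section Symmetrization.
Variables (K : fieldType) (g : lieAlgebraType K).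
Implicit Types (alpha omega : mapn g 2) (phi : bform g).

Lemma pair2_eta (x : 'I_2 -> g) : x = pair2 (x 0) (x 1).
Proof.
apply/funext => -[[|[|k]] hk] //; rewrite /pair2 (tnth_nth 0) /=;
  by congr x; apply: val_inj.
Qed.

Lemma tuple3_eta (x : 'I_3 -> g) : x = tnth [tuple x 0; x 1; x 2].
Proof.
apply/funext => -[[|[|[|k]]] hk] //; rewrite (tnth_nth 0) /=;
  by congr x; apply: val_inj.
Qed.

Lemma multilinear_pair2l alpha (y : g) :
  multilinear alpha -> scalar (fun u => alpha (pair2 u y)).
Proof.
move=> ma a u v.
have E w : pair2 w y = [eta pair2 0 y with (0 : 'I_2) |-> w].
  by rewrite [RHS]pair2_eta.
by rewrite (E (_ + _)) (E u) (E v); apply: ma.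
Qed.

Lemma multilinear_pair2r alpha (x : g) :
  multilinear alpha -> scalar (fun u => alpha (pair2 x u)).
Proof.
move=> ma a u v.
have E w : pair2 x w = [eta pair2 x 0 with (1 : 'I_2) |-> w].
  by rewrite [RHS]pair2_eta.
by rewrite (E (_ + _)) (E u) (E v); apply: ma.
Qed.

Lemma alternating2_diag alpha :
  (forall x, alpha (pair2 x x) = 0) -> alternating alpha.
Proof.
move=> alt x [[|[|i]] hi] [[|[|j]] hj] // _ xij; rewrite [x]pair2_eta.
  by suff -> : x 0 = x 1; [|move: xij; congr (x _ = x _); apply: val_inj].
by suff -> : x 0 = x 1; [|move: (esym xij); congr (x _ = x _); apply: val_inj].
Qed.

Lemma pair2_skew omega x y : lie_cochain omega ->
  omega (pair2 y x) = - omega (pair2 x y).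
Proof. by move=> ho; apply: alternating2. Qed.

Definition cochain_of_form phi : mapn g 2 := fun x => phi (x 0) (x 1).

Lemma cochain_of_form_multilinear phi :
  (forall y, scalar (phi^~ y)) -> (forall x, scalar (phi x)) ->
  multilinear (cochain_of_form phi).
Proof.
by move=> pl pr x [[|[|i]] hi] a u v //; rewrite /cochain_of_form /=;
  [exact: pl | exact: pr].
Qed.

(** Among the three terms [phi(x, [y, z]) + phi([x, z], y) - phi([x, y], z)] of
    the coboundary the outer two cancel by invariance, and the middle one is
    minus [phi([z, x], y)], a cyclic permutation of the Koszul cochain. *)
Lemma loday_d_invariant_form phi : phi \in @invariant_form K g ->
  loday_d (cochain_of_form phi) = - koszul_cochain phi.
Proof.
move=> /asboolP[pl pr ps pi]; apply/funext => x.
rewrite [x]tuple3_eta loday_d2E.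
rewrite /cochain_of_form /pair2 !(tnth_nth 0) /=.
set a := x 0; set b := x 1; set c := x 2.
have -> : (- koszul_cochain phi) (tnth [tuple a; b; c]) = - phi (lie a b) c.
  by rewrite -[LHS]/(- phi _ _) !(tnth_nth 0).
have phiNr u v : phi u (- v) = - phi u v.
  have phi0 : phi u 0 = 0.
    by have := pr u (-1) 0 0; rewrite scaler0 addr0 mulN1r addNr.
  by have := pr u (-1) v 0; rewrite scaleN1r !addr0 phi0 addr0 mulN1r.
by rewrite -pi addrAC subrr add0r pi lieC phiNr -pi.
Qed.

(** * Symmetrization of a Leibniz 2-cocycle *)

(** Write [phi] for the symmetrization.  Expand [phi([x, y], z)] and
    [phi(x, [y, z])] and use the cocycle identity to move every bracket to the
    first argument of [alpha]: up to the antisymmetry of the bracket, the same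
    three terms remain. *)
Lemma symmetrization_invariant alpha :
  alpha \in @leibniz_cocycle K g 2 -> symmetrization alpha \in @invariant_form K g.
Proof.
move=> /asboolP[ma da].
have al := multilinear_pair2l _ ma; have ar := multilinear_pair2r _ ma.
have aN u v w : alpha (pair2 (lie u v) w) = - alpha (pair2 (lie v u) w).
  have a0 : alpha (pair2 0 w) = 0.
    by have := al w (-1) 0 0; rewrite scaler0 addr0 mulN1r addNr.
  have := al w (-1) (lie v u) 0.
  by rewrite scaleN1r !addr0 a0 addr0 mulN1r -lieC.
have co x y z : alpha (pair2 x (lie y z)) =
    alpha (pair2 (lie x y) z) - alpha (pair2 (lie x z) y).
  have /eqP := congr1 (fun f : mapn g 3 => f (tnth [tuple x; y; z])) da.
  rewrite loday_d2E -[X in _ == X]/(0 : K) subr_eq0 => /eqP <-.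
  by rewrite addrK.
apply/asboolP; rewrite /symmetrization; split=> [y a u v|x a u v|x y|x y z] /=.
- by rewrite al ar mulrDr addrACA.
- by rewrite al ar mulrDr addrACA.
- by rewrite addrC.
- by rewrite !co (aN z x) (aN z y) opprK addrA.
Qed.

(** The primitive is the alternating part [omega = 2 alpha - phi]: as
    [d alpha = 0], its coboundary is [- d phi], which is the Koszul cochain of
    [phi]. *)
Lemma koszul_symmetrization_exact alpha :
  alpha \in @leibniz_cocycle K g 2 -> lie_exact (koszul_cochain (symmetrization alpha)).
Proof.
move=> Za; have Ipsi := symmetrization_invariant Za.
have /asboolP[pl pr _ _] := Ipsi; have /asboolP[ma da] := Za.
pose psi := cochain_of_form (symmetrization alpha).
have mpsi : multilinear (- psi).
  rewrite -[- psi]addr0 -scaleN1r; apply: multilinear_lin.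
    exact: cochain_of_form_multilinear.
  exact: multilinear0.
pose omega : mapn g 2 := 2%:R *: alpha + - psi.
have ho : lie_cochain omega.
  split; first exact: multilinear_lin.
  apply: alternating2_diag => x.
  have -> : omega (pair2 x x) = 2%:R * alpha (pair2 x x) - psi (pair2 x x) by [].
  rewrite /psi /cochain_of_form /pair2 !(tnth_nth 0) /=.
  by rewrite /symmetrization -mulr2n mulr_natl subrr.
exists omega => //.
rewrite ce_d2 // loday_d_linear da scaler0 add0r.
have -> : loday_d (- psi) = - loday_d psi by exact: raddfN.
by rewrite /psi loday_d_invariant_form // opprK.
Qed.

Lemma cartan_koszul_eq0 (phi : B g) :
  cartan_koszul g phi = 0 <-> lie_exact (koszul_cochain (val phi)).
Proof.
rewrite -[0](linear0 (@lie_class K g 3)).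
split=> [/quotient_piP|h]; first by rewrite subr0 => /asboolP.
by apply/quotient_piP; rewrite subr0; apply/asboolP.
Qed.

(** [sym_form] and [sym_ker] are the symmetrization map with its codomain cut down
    to invariant forms, then to the kernel of the Cartan-Koszul map. *)
Definition sym_form (alpha : ZL g 2) : B g :=
  mk_subspace (symmetrization_invariant (valP alpha)).

Fact sym_form_ker (alpha : ZL g 2) :
  sym_form alpha \in ker_pred (cartan_koszul g).
Proof.
apply/eqP/cartan_koszul_eq0; exact: koszul_symmetrization_exact (valP alpha).
Qed.

Definition sym_ker (alpha : ZL g 2) : subspace (ker_pred (cartan_koszul g)) :=
  mk_subspace (sym_form_ker alpha).

Fact symmetrization_linear : linear (@symmetrization K g).
Proof.
move=> a u v; apply/funext => x; apply/funext => y.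
have E w : (a *: u + v) w = a * u w + v w by [].
have -> : (a *: symmetrization u + symmetrization v) x y =
  a * symmetrization u x y + symmetrization v x y by [].
by rewrite /symmetrization !E addrACA -mulrDr.
Qed.

Lemma val_sym_ker (alpha : ZL g 2) :
  val (val (sym_ker alpha)) = symmetrization (val alpha).
Proof. by []. Qed.

Fact sym_ker_linear : linear sym_ker.
Proof.
move=> a u v; apply: val_inj; apply: val_inj.
rewrite val_sym_ker.
have -> : val (a *: u + v) = a *: val u + val v := val_subspaceP a u v.
rewrite symmetrization_linear -!val_sym_ker.
by rewrite (val_subspaceP a (sym_ker u)) val_subspaceP.
Qed.
HB.instance Definition _ := GRing.isLinear.Build K (ZL g 2)
  (subspace (ker_pred (cartan_koszul g))) *:%R sym_ker sym_ker_linear.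

Lemma sym_ker_eq0 (alpha : ZL g 2) :
  sym_ker alpha = 0 <-> forall x y, symmetrization (val alpha) x y = 0.
Proof.
split=> [h x y|h]; first by rewrite -[LHS]/(val (val (sym_ker alpha)) x y) h.
by do 2!apply: val_inj; apply/funext => x; apply/funext => y; apply: h.
Qed.

Lemma sym_ker_lie (z : ZCE g 2) : sym_ker (lie2_leibniz z) = 0.
Proof.
apply/sym_ker_eq0 => x y; rewrite /symmetrization /=.
have /asboolP[hz _] := valP z.
by rewrite (pair2_skew x y hz) subrr.
Qed.

Lemma loday_d1E (b : mapn g 1) x y :
  loday_d b (pair2 x y) = - b (fun=> lie x y).
Proof.
have -> : pair2 x y = (fun i : 'I_2 => nth 0 [:: x; y] i).
  by apply/funext => i; rewrite /pair2 (tnth_nth 0).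
rewrite (loday_dE _ (nth 0 [:: x; y])) !big_ord_recl big_ord0.
rewrite !(big_mkcond (fun i : 'I_2 => (i < _)%N)) /=.
rewrite !big_ord_recl !big_ord0 /= !addr0 !add0r.
rewrite expr1 mulN1r; congr (- b _).
by apply/funext => -[[|k] hk].
Qed.

Lemma sym_ker_coboundary (alpha : ZL g 2) :
  alpha \in @leibniz_coboundary K g 2 -> sym_ker alpha = 0.
Proof.
move=> /asboolP[b mb eb]; apply/sym_ker_eq0 => x y.
rewrite /symmetrization eb !loday_d1E.
have bl : scalar (fun u => b (fun=> u)).
  move=> a u v.
  have E w : (fun=> w) = [eta (fun=> 0 : g) with (0 : 'I_1) |-> w].
    by apply/funext => i /=; rewrite ord1.
  by rewrite (E (_ + _)) (E u) (E v); apply: mb.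
have b0 : b (fun=> 0) = 0.
  by have := bl (-1) 0 0; rewrite scaler0 addr0 mulN1r addNr.
have := bl (-1) (lie x y) 0.
by rewrite scaleN1r !addr0 b0 addr0 mulN1r -lieC => ->; rewrite opprK addNr.
Qed.

(** * Inverting 2 *)

Section CharNot2.
Hypothesis two_neq0 : 2%:R != 0 :> K.

(** On the diagonal the symmetrization is [2 alpha(x, x)], so a cocycle that it
    kills is alternating, and for such cochains the two differentials agree. *)
Lemma sym_ker0_lie (alpha : ZL g 2) :
  sym_ker alpha = 0 -> exists z, alpha = lie2_leibniz z.
Proof.
move=> /sym_ker_eq0 s0; have /asboolP[ma da] := valP alpha.
have ha : lie_cochain (val alpha).
  split=> //; apply: alternating2_diag => x; apply/eqP.
  have /eqP := s0 x x; rewrite /symmetrization -mulr2n -mulr_natl mulf_eq0.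
  by rewrite (negPf two_neq0).
have Zc : val alpha \in @lie_cocycle K g 2 by apply/asboolP; rewrite ce_d2.
by exists (mk_subspace Zc); apply: val_inj.
Qed.

(** If [omega] is a primitive of the Koszul cochain of [phi], the coboundaries of
    [phi] and [omega] are opposite, so [phi + omega] is a Leibniz cocycle; its
    symmetrization is [2 phi] because [omega] is skew. *)
Lemma sym_ker_surj (phi : subspace (ker_pred (cartan_koszul g))) :
  exists alpha : ZL g 2, sym_ker alpha = phi.
Proof.
have Ipsi := valP (val phi); have /asboolP[pl pr ps _] := Ipsi.
have /eqP/cartan_koszul_eq0[omega ho dom] := valP phi.
pose psi := cochain_of_form (val (val phi)).
have Zbeta : omega + psi \in @leibniz_cocycle K g 2.
  apply/asboolP; split.
    rewrite -[omega]scale1r; apply: multilinear_lin; first by case: ho.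
    exact: cochain_of_form_multilinear.
  have -> : loday_d (omega + psi) = loday_d omega + loday_d psi by exact: raddfD.
  rewrite /psi loday_d_invariant_form //.
  by rewrite -ce_d2 // -dom subrr.
pose beta : ZL g 2 := mk_subspace Zbeta.
have symbeta : sym_ker beta = 2%:R *: phi.
  do 2!apply: val_inj; rewrite val_sym_ker !val_subspaceZ.
  apply/funext => x; apply/funext => y.
  have -> : symmetrization (val beta) x y = omega (pair2 x y) + psi (pair2 x y) +
      (omega (pair2 y x) + psi (pair2 y x)) by [].
  have -> : (2%:R *: val (val phi)) x y = 2%:R * val (val phi) x y by [].
  rewrite (pair2_skew x y ho) addrACA subrr add0r.
  rewrite /psi /cochain_of_form /pair2 !(tnth_nth 0) /=.
  by rewrite (ps y x) -mulr2n mulr_natl.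
exists (2%:R^-1 *: beta).
have -> : sym_ker (2%:R^-1 *: beta) = 2%:R^-1 *: sym_ker beta by exact: linearZ.
by rewrite symbeta scalerA mulVf // scale1r.
Qed.

End CharNot2.
End Symmetrization.

(** * The isomorphism *)

Theorem corollary3p3 (K : closedFieldType) (charK : [pchar K] =i pred0)
    (g : lieAlgebraType K) :
  (exists Phi : {linear quotient (range_pred (H2_to_HL2 g)) ->
                        subspace (ker_pred (cartan_koszul g))},
     bijective Phi /\
     forall alpha : ZL g 2,
       val (val (Phi (quotient_pi (range_pred (H2_to_HL2 g))
                                  (leibniz_class alpha)))) =
       symmetrization (val alpha)) /\
  ((forall c : HL g 2, exists c' : HCE g 2, H2_to_HL2 g c' = c) <->
   (forall phi : B g, cartan_koszul g phi = 0 -> phi = 0)).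
Proof.
have two_neq0 : 2%:R != 0 :> K by rewrite (pcharf0P K).1.
(* [F] is symmetrization on cohomology classes, [Phi] its lift modulo the image
   of Lie cohomology. *)
pose F : {linear HL g 2 -> subspace (ker_pred (cartan_koszul g))} :=
  quotient_lift (@sym_ker_coboundary K g).
have FE alpha : F (leibniz_class alpha) = sym_ker alpha.
  exact: (quotient_liftE (@sym_ker_coboundary K g)).
have Hsurj (c : HL g 2) : exists alpha, c = leibniz_class alpha.
  by exists (quotient_repr c); rewrite /leibniz_class quotient_reprK.
have rangeP c : c \in range_pred (H2_to_HL2 g) <-> exists c', H2_to_HL2 g c' = c.
  by split=> [/asboolP|h] //; apply/asboolP.
have F0 c : c \in range_pred (H2_to_HL2 g) -> F c = 0.
  move=> /rangeP[c' <-]; have [z ->] := lie_class_surj c'.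
  by rewrite H2_to_HL2_class FE sym_ker_lie.
have kerF c : F c = 0 -> c \in range_pred (H2_to_HL2 g).
  have [alpha ->] := Hsurj c; rewrite FE => /(sym_ker0_lie two_neq0)[z ->].
  by apply/rangeP; exists (lie_class z); rewrite H2_to_HL2_class.
have Fsurj phi : exists c, F c = phi.
  have [alpha <-] := sym_ker_surj two_neq0 phi.
  by exists (leibniz_class alpha).
split.
  exists (quotient_lift F0); split; first exact: quotient_lift_bij.
  move=> alpha.
  have E := etrans (quotient_liftE F0 (leibniz_class alpha)) (FE alpha).
  by rewrite -val_sym_ker -E.
split=> [onto phi hphi|ker0 c].
  have kphi : phi \in ker_pred (cartan_koszul g) by apply/eqP.
  have [c Fc] := Fsurj (mk_subspace kphi).
  have [c' cE] := onto c.
  have : F c = 0 by apply: F0; apply: (rangeP c).2; exists c'.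
  by rewrite Fc => /(congr1 val).
have : F c = 0 by apply: val_inj; apply: ker0; apply/eqP; exact: (valP (F c)).
by move=> /kerF/rangeP.
Qed.
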